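(* Let $w\le -1$ be an integer and let $\mathsf{H}$ be a $|w|$-Hom-configuration in $\mathsf{T}_w$. The following are equivalent: (1) $\mathsf{H}$ is a left $|w|$-Riedtmann configuration; (2) $\mathsf{H}$ is a right $|w|$-Riedtmann configuration; (3) there are at most $|w|-1$ isolated vertices with no overarcs (with respect to the set of arcs of $\mathsf{H}$).
   Context: Let $K$ be an algebraically closed field, $w$ a negative integer and $d:=w-1$ (so $|d|=|w|+1$). $\mathsf{T}=\mathsf{T}_w$ denotes a $K$-linear idempotent complete algebraic triangulated category, with shift $\Sigma$, classically generated by a $w$-spherical object, i.e. an object $s$ with $\dim_K\mathrm{Hom}(s,\Sigma^i s)=1$ if $i\in\{0,w\}$ and $0$ otherwise. It is known that $\mathsf{T}$ is unique up to triangle equivalence, Krull–Schmidt with finite dimensional Hom-spaces, and $w$-Calabi–Yau: $\mathrm{Hom}(x,y)\cong D\,\mathrm{Hom}(y,\Sigma^w x)$ bifunctorially. Write $\mathrm{Ext}^i(x,y):=\mathrm{Hom}_{\mathsf{T}}(x,\Sigma^i y)$ for $i\in\mathbb{Z}$. Arc model. The vertices of the $\infty$-gon are the integers. A $d$-admissible arc is a pair $(t,u)$ of integers with $t>u$, $t-u\ge |d|-1$ and $u-t\equiv 1 \pmod d$; its endpoints are $t$ and $u$. Isomorphism classes of indecomposable objects of $\mathsf{T}$ are identified with $d$-admissible arcs in such a way that $\Sigma(t,u)=(t-1,u-1)$ and the arrows of the Auslander–Reiten quiver are $(t,u)\to(t,u+d)$ and $(t,u)\to(t+d,u)$ whenever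 the target is $d$-admissible (this fixes the identification up to powers of $\Sigma$). Under it, for $x=(t,u)$ and $k:=\frac{u-t-1}{d}$, $\dim_K\mathrm{Hom}(x,y)=1$ if $y$ is a $d$-admissible arc of the form $(t+id,v)$ with $0\le i\le k-1$, $v\le u$, or of the form $(z,u-w-id)$ with $0\le i\le k-1$, $z\ge t-w$; otherwise $\mathrm{Hom}(x,y)=0$. For a collection $X$ of objects, $X^{\perp_i}:=\{y\in\mathsf{T}\mid \mathrm{Ext}^i(x,y)=0 \text{ for all } x\in X\}$. A collection $\mathsf{H}$ of (isomorphism classes of) indecomposable objects of $\mathsf{T}$ is a $|w|$-Hom-configuration if for every indecomposable $h$: $h\in\mathsf{H}$ if and only if $h\in\mathsf{H}^{\perp_i}$ for $i=w+1,\dots,-1$ and $h\in(\mathsf{H}\setminus\{h\})^{\perp_i}$ for $i=0,w$. A collection $\mathsf{C}$ of indecomposable objects of $\mathsf{T}$ is a left $|w|$-Riedtmann configuration if (a) $\mathrm{Ext}^i(x,y)=0$ for all $x,y\in\mathsf{C}$ with $x\neq y$ and all $i\in\{w,\dots,0\}$, and (b) for every indecomposable $z\in\mathsf{T}$ there are $x\in\mathsf{C}$ and $i\in\{w+1,\dots,0\}$ with $\mathrm{Ext}^i(x,z)\neq0$. It is a right $|w|$-Riedtmann configuration if it satisfies (a) and (b$'$) for every indecomposable $z\in\mathsf{T}$ there are $x\in\mathsf{C}$ and $i\in\{w+1,\dots,0\}$ with $\mathrm{Ext}^i(z,x)\neq 0$. Given a set $\mathsf{H}$ of arcs, a vertex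 is isolated if it is not an endpoint of any arc in $\mathsf{H}$; an overarc of a vertex $v$ is an arc $(t,u)\in\mathsf{H}$ with $u<v<t$. *)

(* Defs.v *)
From HB Require Import structures.
From mathcomp Require Import all_boot all_order all_algebra.
From mathcomp Require Import classical_sets cardinality.

Set Implicit Arguments.
Unset Strict Implicit.
Unset Printing Implicit Defensive.

Import Order.TTheory GRing.Theory Num.Theory.

Local Open Scope ring_scope.
Local Open Scope classical_set_scope.

Definition has_dim (K : fieldType) (V : lmodType K) (n : nat) : Prop :=
  exists2 f : V -> 'rV[K]_n, linear f & bijective f.

Record linCat (K : fieldType) := LinCat {
  ob :> Type;
  homs : ob -> ob -> lmodType K;
  idmor : forall x, homs x x;
  compm : forall x y z, homs y z -> homs x y -> homs x z;
  compA : forall x y z t (h : homs z t) (g : homs y z) (f : homs x y),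
    compm h (compm g f) = compm (compm h g) f;
  comp1m : forall x y (f : homs x y), compm (idmor y) f = f;
  compm1 : forall x y (f : homs x y), compm f (idmor x) = f;
  comp_linl : forall x y z (a : K) (g g' : homs y z) (f : homs x y),
    compm (a *: g + g') f = a *: compm g f + compm g' f;
  comp_linr : forall x y z (a : K) (g : homs y z) (f f' : homs x y),
    compm g (a *: f + f') = a *: compm g f + compm g f' }.

Arguments homs {K l} x y.
Arguments idmor {K l} x.
Arguments compm {K l x y z} g f.

Declare Scope cat_scope.
Notation "g \oo f" := (compm g f) (at level 40, left associativity) : cat_scope.
Local Open Scope cat_scope.

Section Category.
Variables (K : fieldType) (C : linCat K).
Implicit Types x y z a b : C.

Definition is_iso x y (f : homs x y) : Prop :=
  exists2 g : homs y x, g \oo f = idmor x & f \oo g = idmor y.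

Definition isomorphic x y : Prop := exists f : homs x y, is_iso f.

Definition split_mono x y (f : homs x y) : Prop :=
  exists g : homs y x, g \oo f = idmor x.

Definition split_epi x y (f : homs x y) : Prop :=
  exists g : homs y x, f \oo g = idmor y.

Definition irreducible_morphism x y (f : homs x y) : Prop :=
  [/\ ~ split_mono f, ~ split_epi f &
      forall z (h : homs x z) (g : homs z y),
        f = g \oo h -> split_mono h \/ split_epi g].

Definition zero_object x : Prop := idmor x = 0.

Definition is_biproduct x a b : Prop :=
  exists (ia : homs a x) (ib : homs b x) (pa : homs x a) (pb : homs x b),
    [/\ pa \oo ia = idmor a, pb \oo ib = idmor b,
        pa \oo ib = 0, pb \oo ia = 0 &
        ia \oo pa + ib \oo pb = idmor x].

Definition indecomposable x : Prop :=
  ~ zero_object x /\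
  forall a b, is_biproduct x a b -> zero_object a \/ zero_object b.

Definition additive_category : Prop :=
  (exists x, zero_object x) /\ (forall a b, exists x, is_biproduct x a b).

Definition idempotent_complete : Prop :=
  forall x (e : homs x x), e \oo e = e ->
  exists y (r : homs x y) (s : homs y x), s \oo r = e /\ r \oo s = idmor y.

Definition is_kernel x y z (i : homs x y) (p : homs y z) : Prop :=
  p \oo i = 0 /\
  forall a (f : homs a y), p \oo f = 0 -> exists! g : homs a x, i \oo g = f.

Definition is_cokernel x y z (i : homs x y) (p : homs y z) : Prop :=
  p \oo i = 0 /\
  forall a (f : homs y a), f \oo i = 0 -> exists! g : homs z a, g \oo p = f.

Definition is_pushout x y x' y' (i : homs x y) (f : homs x x')
    (f' : homs y y') (i' : homs x' y') : Prop :=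
  f' \oo i = i' \oo f /\
  forall q (a : homs y q) (b : homs x' q), a \oo i = b \oo f ->
    exists! c : homs y' q, c \oo f' = a /\ c \oo i' = b.

Definition is_pullback y z y' z' (p : homs y z) (f : homs z' z)
    (f' : homs y' y) (p' : homs y' z') : Prop :=
  p \oo f' = f \oo p' /\
  forall q (a : homs q y) (b : homs q z'), p \oo a = f \oo b ->
    exists! c : homs q y', f' \oo c = a /\ p' \oo c = b.

(* Collections of isomorphism classes of indecomposable objects are encoded
   as isomorphism-closed sets of indecomposable objects. *)
Definition indec_collection (X : set C) : Prop :=
  (forall x, X x -> indecomposable x) /\
  (forall x y, X x -> isomorphic x y -> X y).

Definition minus_class (X : set C) (h : C) : set C :=
  [set x | X x /\ ~ isomorphic x h].

End Category.

Record linFunctor (K : fieldType) (C D : linCat K) := LinFunctor {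
  fob :> C -> D;
  fmap : forall x y, homs x y -> homs (fob x) (fob y);
  fmap_lin : forall x y (a : K) (f g : homs x y),
    fmap (a *: f + g) = a *: fmap f + fmap g;
  fmap1 : forall x, fmap (idmor x) = idmor (fob x);
  fmapM : forall x y z (g : homs y z) (f : homs x y),
    fmap (g \oo f) = fmap g \oo fmap f }.

Arguments fmap {K C D} F {x y} f : rename.

(* The shift is an autoequivalence, with a chosen quasi-inverse [desusp];
   the octahedral axiom is included. *)
Record triCat (K : fieldType) := TriCat {
  tri_lin :> linCat K;
  tri_additive : additive_category tri_lin;
  susp : linFunctor tri_lin tri_lin;
  desusp : linFunctor tri_lin tri_lin;
  susp_unit : forall x : tri_lin, homs x (susp (desusp x));
  susp_unit_iso : forall x, is_iso (susp_unit x);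
  susp_unit_nat : forall (x y : tri_lin) (f : homs x y),
    susp_unit y \oo f = fmap susp (fmap desusp f) \oo susp_unit x;
  susp_counit : forall x : tri_lin, homs (desusp (susp x)) x;
  susp_counit_iso : forall x, is_iso (susp_counit x);
  susp_counit_nat : forall (x y : tri_lin) (f : homs x y),
    susp_counit y \oo fmap desusp (fmap susp f) = f \oo susp_counit x;
  dist : forall x y z : tri_lin,
    homs x y -> homs y z -> homs z (susp x) -> Prop;
  dist_iso : forall (x y z x' y' z' : tri_lin)
      (f : homs x y) (g : homs y z) (h : homs z (susp x))
      (f' : homs x' y') (g' : homs y' z') (h' : homs z' (susp x'))
      (a : homs x x') (b : homs y y') (c : homs z z'),
    is_iso a -> is_iso b -> is_iso c ->
    b \oo f = f' \oo a -> c \oo g = g' \oo b ->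
    fmap susp a \oo h = h' \oo c ->
    dist f g h -> dist f' g' h';
  dist_id : forall x z : tri_lin, zero_object z ->
    dist (idmor x) (0 : homs x z) (0 : homs z (susp x));
  dist_cone : forall (x y : tri_lin) (f : homs x y),
    exists (z : tri_lin) (g : homs y z) (h : homs z (susp x)), dist f g h;
  dist_rot : forall (x y z : tri_lin)
      (f : homs x y) (g : homs y z) (h : homs z (susp x)),
    dist f g h <-> dist g h (- fmap susp f);
  dist_mor : forall (x y z x' y' z' : tri_lin)
      (f : homs x y) (g : homs y z) (h : homs z (susp x))
      (f' : homs x' y') (g' : homs y' z') (h' : homs z' (susp x'))
      (a : homs x x') (b : homs y y'),
    dist f g h -> dist f' g' h' -> b \oo f = f' \oo a ->
    exists2 c : homs z z', c \oo g = g' \oo b & fmap susp a \oo h = h' \oo c;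
  dist_oct : forall (x y z c1 c2 c3 : tri_lin)
      (f : homs x y) (f1 : homs y c1) (f2 : homs c1 (susp x))
      (g : homs y z) (g1 : homs z c2) (g2 : homs c2 (susp y))
      (h1 : homs z c3) (h2 : homs c3 (susp x)),
    dist f f1 f2 -> dist g g1 g2 -> dist (g \oo f) h1 h2 ->
    exists (u : homs c1 c3) (v : homs c3 c2),
      [/\ u \oo f1 = h1 \oo g, h2 \oo u = f2,
          v \oo h1 = g1, g2 \oo v = fmap susp f \oo h2 &
          dist u v (fmap susp f1 \oo g2)] }.

Arguments susp {K} T : rename.
Arguments desusp {K} T : rename.
Arguments dist {K T x y z} f g h : rename.

(* Quillen exact structures: the pairs in [conf] are the conflations. *)
Record exactCat (K : fieldType) := ExactCat {
  ex_lin :> linCat K;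
  ex_additive : additive_category ex_lin;
  conf : forall x y z : ex_lin, homs x y -> homs y z -> Prop;
  inflation := fun (x y : ex_lin) (i : homs x y) =>
    exists (z : ex_lin) (p : homs y z), conf i p;
  deflation := fun (y z : ex_lin) (p : homs y z) =>
    exists (x : ex_lin) (i : homs x y), conf i p;
  conf_kernel : forall (x y z : ex_lin) (i : homs x y) (p : homs y z),
    conf i p -> is_kernel i p /\ is_cokernel i p;
  conf_iso : forall (x y z x' y' z' : ex_lin)
      (i : homs x y) (p : homs y z) (i' : homs x' y') (p' : homs y' z')
      (a : homs x x') (b : homs y y') (c : homs z z'),
    is_iso a -> is_iso b -> is_iso c ->
    b \oo i = i' \oo a -> c \oo p = p' \oo b -> conf i p -> conf i' p';
  inflation_id : forall x : ex_lin, inflation (idmor x);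
  deflation_id : forall x : ex_lin, deflation (idmor x);
  inflation_comp : forall (x y z : ex_lin) (i : homs x y) (j : homs y z),
    inflation i -> inflation j -> inflation (j \oo i);
  deflation_comp : forall (x y z : ex_lin) (p : homs x y) (q : homs y z),
    deflation p -> deflation q -> deflation (q \oo p);
  inflation_pushout : forall (x y x' : ex_lin) (i : homs x y) (f : homs x x'),
    inflation i ->
    exists (y' : ex_lin) (f' : homs y y') (i' : homs x' y'),
      is_pushout i f f' i' /\ inflation i';
  deflation_pullback : forall (y z z' : ex_lin) (p : homs y z) (f : homs z' z),
    deflation p ->
    exists (y' : ex_lin) (f' : homs y' y) (p' : homs y' z'),
      is_pullback p f f' p' /\ deflation p' }.

Arguments conf {K E x y z} i p : rename.
Arguments inflation {K E x y} i : rename.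
Arguments deflation {K E y z} p : rename.

Section Frobenius.
Variables (K : fieldType) (E : exactCat K).

Definition projective_object (P : E) : Prop :=
  forall (y z : E) (p : homs y z) (f : homs P z), deflation p ->
  exists g : homs P y, p \oo g = f.

Definition injective_object (I : E) : Prop :=
  forall (x y : E) (i : homs x y) (f : homs x I), inflation i ->
  exists g : homs y I, g \oo i = f.

Definition frobenius : Prop :=
  [/\ forall x : E, exists (P : E) (p : homs P x),
        projective_object P /\ deflation p,
      forall x : E, exists (I : E) (i : homs x I),
        injective_object I /\ inflation i &
      forall x : E, projective_object x <-> injective_object x].

Definition factors_through_projective (x y : E) (f : homs x y) : Prop :=
  exists (P : E) (h : homs x P) (g : homs P y),
    projective_object P /\ f = g \oo h.

End Frobenius.

Section Triangulated.
Variables (K : fieldType) (T : triCat K).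
Implicit Types x y z : T.

(* [Q] vanishes exactly on the morphisms that factor through a projective
   object, is full and essentially surjective, i.e. it amounts to an
   equivalence from the stable category of the Frobenius category [E] to [T].
   In the stable category the shift of [x] is [S x], for chosen conflations
   x -> I x -> S x with [I x] injective, and the standard triangle of a
   conflation x -> y -> z has as third morphism the class of any [b] in a
   morphism (1, a, b) of conflations from x -> y -> z to x -> I x -> S x; the
   natural isomorphism [phi] makes the equivalence a triangle functor. *)
Definition stable_equivalence (E : exactCat K) (Q : linFunctor E T) : Prop :=
  [/\ forall y, exists x : E, isomorphic (Q x) y,
      forall (x y : E) (g : homs (Q x) (Q y)), exists f, fmap Q f = g,
      forall (x y : E) (f : homs x y),
        fmap Q f = 0 <-> factors_through_projective f &
      exists (I S : E -> E) (iota : forall x : E, homs x (I x))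
             (pi : forall x : E, homs (I x) (S x))
             (phi : forall x : E, homs (Q (S x)) (susp T (Q x))),
      [/\ forall x : E, injective_object (I x) /\ conf (iota x) (pi x),
          forall x : E, is_iso (phi x),
          forall (x x' : E) (f : homs x x') (g : homs (I x) (I x'))
                 (s : homs (S x) (S x')),
            g \oo iota x = iota x' \oo f -> s \oo pi x = pi x' \oo g ->
            phi x' \oo fmap Q s = fmap (susp T) (fmap Q f) \oo phi x &
          forall (x y z : E) (i : homs x y) (p : homs y z)
                 (a : homs y (I x)) (b : homs z (S x)),
            conf i p -> a \oo i = iota x -> b \oo p = pi x \oo a ->
            dist (fmap Q i) (fmap Q p) (phi x \oo fmap Q b)]].

Definition algebraic : Prop :=
  exists (E : exactCat K) (Q : linFunctor E T),
    frobenius E /\ stable_equivalence Q.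

Definition thick (P : set T) : Prop :=
  [/\ forall x y, P x -> isomorphic x y -> P y,
      forall x, P x -> P (susp T x) /\ P (desusp T x),
      forall x y z (f : homs x y) (g : homs y z) (h : homs z (susp T x)),
        dist f g h -> P x -> P y -> P z &
      forall x y z, P x -> is_biproduct x y z -> P y].

Definition classically_generates (s : T) : Prop :=
  forall P : set T, thick P -> P s -> forall x, P x.

Definition shiftz (i : int) (x : T) : T :=
  match i with
  | Posz n => iter n (susp T) x
  | Negz n => iter n.+1 (desusp T) x
  end.

Definition Ext (i : int) (x y : T) : lmodType K := homs x (shiftz i y).

Definition Ext_zero (i : int) (x y : T) : Prop := forall f : Ext i x y, f = 0.

Definition spherical (w : int) (s : T) : Prop :=
  forall i : int, has_dim (Ext i s s) (if (i == 0) || (i == w) then 1 else 0).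

Definition is_Tw (w : int) : Prop :=
  [/\ idempotent_complete T, algebraic &
      exists2 s : T, spherical w s & classically_generates s].

Definition perp (i : int) (X : set T) : set T :=
  [set y | forall x, X x -> Ext_zero i x y].

Definition hom_configuration (w : int) (H : set T) : Prop :=
  indec_collection H /\
  forall h : T, indecomposable h ->
    (H h <->
     (forall i : int, w + 1 <= i <= -1 -> perp i H h) /\
     (forall i : int, i = 0 \/ i = w -> perp i (minus_class H h) h)).

Definition riedtmann_orthogonal (w : int) (C : set T) : Prop :=
  forall x y, C x -> C y -> ~ isomorphic x y ->
  forall i : int, w <= i <= 0 -> Ext_zero i x y.

Definition left_riedtmann (w : int) (C : set T) : Prop :=
  [/\ indec_collection C, riedtmann_orthogonal w C &
      forall z, indecomposable z ->
        exists x, C x /\ exists2 i : int, w + 1 <= i <= 0 & ~ Ext_zero i x z].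

Definition right_riedtmann (w : int) (C : set T) : Prop :=
  [/\ indec_collection C, riedtmann_orthogonal w C &
      forall z, indecomposable z ->
        exists x, C x /\ exists2 i : int, w + 1 <= i <= 0 & ~ Ext_zero i z x].

End Triangulated.

Section Arcs.
Variable w : int.
Let d : int := w - 1.

Definition admissible (a : int * int) : Prop :=
  let: (t, u) := a in
  [/\ u < t, `|d| - 1 <= t - u & (u - t = 1 %[mod d])%Z].

Definition ar_arrow (a b : int * int) : Prop :=
  let: (t, u) := a in
  admissible b /\ (b = (t, u + d) \/ b = (t + d, u)).

Definition hom_arc (a b : int * int) : Prop :=
  let: (t, u) := a in
  let k := ((u - t - 1) %/ d)%Z in
  admissible b /\
  exists i : int, 0 <= i <= k - 1 /\
    ((exists2 v : int, v <= u & b = (t + i * d, v)) \/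
     (exists2 z : int, t - w <= z & b = (z, u - w - i * d))).

End Arcs.

(* An identification of the isomorphism classes of indecomposable objects
   with the d-admissible arcs, d = w - 1; [obj] picks a representative of the
   class of each arc, and its values elsewhere are irrelevant. The Hom-spaces
   being at most one-dimensional, the Auslander-Reiten quiver has no multiple
   arrows. *)
Record arc_model (K : fieldType) (w : int) (T : triCat K) := ArcModel {
  obj :> int * int -> T;
  obj_indec : forall a, admissible w a -> indecomposable (obj a);
  obj_inj : forall a b, admissible w a -> admissible w b ->
    isomorphic (obj a) (obj b) -> a = b;
  obj_surj : forall x : T, indecomposable x ->
    exists2 a, admissible w a & isomorphic (obj a) x;
  obj_susp : forall t u : int, admissible w (t, u) ->
    isomorphic (susp T (obj (t, u))) (obj (t - 1, u - 1));
  obj_ar : forall a b, admissible w a -> admissible w b ->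
    ((exists f : homs (obj a) (obj b), irreducible_morphism f)
     <-> ar_arrow w a b);
  obj_hom1 : forall a b, admissible w a -> admissible w b ->
    hom_arc w a b -> has_dim (homs (obj a) (obj b)) 1;
  obj_hom0 : forall a b, admissible w a -> admissible w b ->
    ~ hom_arc w a b -> has_dim (homs (obj a) (obj b)) 0 }.

Definition arcs_of (K : fieldType) (w : int) (T : triCat K)
    (M : arc_model w T) (H : set T) : set (int * int) :=
  [set a | admissible w a /\ H (M a)].

Definition isolated (A : set (int * int)) (v : int) : Prop :=
  forall t u : int, A (t, u) -> v <> t /\ v <> u.

Definition overarc (A : set (int * int)) (v : int) (a : int * int) : Prop :=
  A a /\ a.2 < v < a.1.

Definition isolated_uncovered (A : set (int * int)) : set int :=
  [set v | isolated A v /\ ~ exists a, overarc A v a].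

(* Main.v *)
Require Import Defs.
From HB Require Import structures.
From mathcomp Require Import all_boot all_order all_algebra.
From mathcomp Require Import classical_sets cardinality.
From mathcomp Require Import boolp functions zify.

Set Implicit Arguments.
Unset Strict Implicit.
Unset Printing Implicit Defensive.

Import Order.TTheory GRing.Theory Num.Theory.

Local Open Scope ring_scope.
Local Open Scope classical_set_scope.
Local Open Scope card_scope.

(** The statement only depends on arcs. Put D = 1 - w, so that admissible arcs
    are the pairs (t, u) with u < t and D dividing the number t - u + 1 of
    vertices from u to t. For two arcs x and z, the endpoints of z shifted by
    0, 1, ..., D - 1 run once through every residue class, and the description
    of Hom-spaces shows that Ext^i(x, z) is nonzero for some i in [w, 0]
    exactly when x and z cross or share an endpoint ([touchP]). Thus a
    Hom-configuration is a maximal family A of pairwise disjoint arcs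
    ([arcs_of_maximal]), condition (a) is automatic for it, and only condition
    (b) or (b') remains. Leaving out i = w means requiring in addition that
    the endpoint of z lying under x be incongruent modulo D to the lower
    endpoint of x ([left_touchP]).

    Call an interval closed when every arc of A has both or neither of its
    endpoints in it, and call free the vertices of such an interval that are
    not on or under an arc contained in it. The outermost arcs fill up the rest
    in blocks whose sizes are multiples of D, so the number of free vertices is
    congruent to the size of the interval ([region_free_seq]), and the i-th
    free vertex, counted from 0, is congruent to the lower end plus i.
    Maximality forces the number of free vertices to be less than D
    ([region_free_size]): otherwise the first and
    the D-th free vertex would be joined by an arc disjoint from A. So it is the
    remainder of the size modulo D.

    Call a closed interval special when its size is -1 modulo D; it has D - 1
    free vertices. It lies under no arc: the interior of the innermost such arc
    would be a closed interval of size -2 modulo D with at least D - 1 free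
    vertices ([special_region_uncovered]). Hence its free vertices are isolated
    without overarc, and conversely D - 1 = |w| such vertices span a special
    interval ([special_region_seqP]). So (3) says that there is no special
    interval.

    Finally, (b) fails for some arc z exactly when a special interval exists.
    The vertices next to a special interval are endpoints of two arcs of A
    leading away from it, and z joins the far end of the left one to the near
    end of the right one ([special_region_not_left]). Conversely, if z is an
    arc for which (b) fails, then the arcs of A meeting z at its two ends
    delimit a special interval ([not_left_special_region]). Condition (b') is
    condition (b) for the family reflected by v |-> - v ([right_isolatedP]),
    while (3) is invariant under this reflection. *)

(** * Arcs and families of arcs *)

(** The d-admissible arcs for d = - D, see [admissibleP]; an arc is the pair of
    its upper and its lower endpoint, in this order. *)
Definition arc (D : int) (a : int * int) : Prop :=
  a.2 < a.1 /\ (D %| a.1 - a.2 + 1)%Z.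

(** Two arcs touch when they cross, share an endpoint, or are equal. *)
Definition touch (a b : int * int) : bool :=
  [&& b.2 <= a.2, a.2 <= b.1 & b.1 <= a.1] ||
  [&& a.2 <= b.2, b.2 <= a.1 & a.1 <= b.1].

(** Touching arcs [a] and [b] such that the upper endpoint of [b] in the first
    case of [touch], or its lower endpoint in the second case, is incongruent
    modulo [D] to the lower endpoint of [a]. *)
Definition left_touch (D : int) (a b : int * int) : bool :=
  [&& b.2 <= a.2 <= b.1, b.1 <= a.1 & ~~ (D %| b.1 - a.2)%Z] ||
  [&& a.2 <= b.2 <= a.1, a.1 <= b.1 & ~~ (D %| b.2 - a.2)%Z].

(** Maximal families of pairwise non-touching arcs. *)
Definition maximal_arcs (D : int) (A : set (int * int)) : Prop :=
  (forall a, A a -> arc D a) /\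
  forall a, arc D a -> (A a <-> forall x, A x -> x <> a -> ~~ touch x a).

(** The interval [a, b] of vertices contains both endpoints or neither endpoint
    of each arc of the family; b = a - 1 encodes the empty interval. *)
Definition closed_region (A : set (int * int)) (a b : int) : Prop :=
  forall t u, A (t, u) -> (a <= t <= b) = (a <= u <= b).

(** [v] is a vertex of [a, b] that is neither an endpoint of, nor covered by, an
    arc contained in [a, b]. Other arcs are ignored. *)
Definition region_free (A : set (int * int)) (a b v : int) : Prop :=
  a <= v <= b /\
  forall t u, A (t, u) -> a <= u -> t <= b -> ~~ (u <= v <= t).

Lemma pos_multiple (D m : int) : 0 < D -> 0 < m * D -> D <= m * D.
Proof. by move=> D0 mD; have m1 : 1 <= m; nia. Qed.

(** The largest element of [P], with default value [lo - 1] when [P] is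
    empty. *)
Lemma max_below (P : int -> Prop) (lo hi : int) :
  lo <= hi -> (forall s, P s -> lo <= s < hi) ->
  exists p, [/\ lo - 1 <= p < hi, p = lo - 1 \/ P p
    & forall s, P s -> s <= p].
Proof.
move=> lohi; have [n] : exists n : nat, hi = lo + n%:Z.
  by exists (absz (hi - lo)%R); lia.
elim: n hi {lohi} => [|n IHn] hi -> Pb.
  by exists (lo - 1); split; [lia | left | move=> s /Pb; lia].
have [Pn|nPn] := pselect (P (lo + n%:Z)).
  by exists (lo + n%:Z); split; [lia | right | move=> s /Pb; lia].
have [s Ps|p [pb pP pm]] := IHn _ erefl.
  have sn : s <> lo + n%:Z by move=> sE; apply: nPn; rewrite -sE.
  by have := Pb _ Ps; lia.
by exists p; split=> //; lia.
Qed.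

(** The smallest element of [P], with default value [hi + 1] when [P] is
    empty. *)
Lemma min_above (P : int -> Prop) (lo hi : int) :
  lo <= hi -> (forall s, P s -> lo < s <= hi) ->
  exists q, [/\ lo < q <= hi + 1, q = hi + 1 \/ P q
    & forall s, P s -> q <= s].
Proof.
move=> lohi Pb.
have [||p [pb pP pm]] := @max_below (fun s => P (- s)) (- hi) (- lo); first lia.
  by move=> s /Pb; lia.
exists (- p); split; first lia.
  by case: pP => [->|]; [left; lia | right].
by move=> s Ps; have := pm (- s); rewrite opprK => /(_ Ps); lia.
Qed.

Lemma seq_bounds (s : seq int) : (0 < size s)%N ->
  exists a b, [/\ a \in s, b \in s & forall x, x \in s -> a <= x <= b].
Proof.
elim: s => // x [|y s] IHs _.
  by exists x, x; split; rewrite ?inE // => z; rewrite inE => /eqP ->; lia.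
have [//|a [b [as_ bs sab]]] := IHs.
exists (Order.min x a), (Order.max x b); split.
- by rewrite inE; case: (leP x a) => _; rewrite ?eqxx ?as_ ?orbT.
- by rewrite inE; case: (leP x b) => _; rewrite ?eqxx ?bs ?orbT.
- by move=> z; rewrite inE => /orP[/eqP -> | /sab]; lia.
Qed.

(** * Closed intervals in a maximal family *)

Section Config.
Variables (D : int) (A : set (int * int)).
Hypotheses (D2 : 2 <= D) (maxA : maximal_arcs D A).
Implicit Types a b t u v : int.

Lemma small_multiple (k : int) : - D < k * D < D -> k = 0.
Proof. by move=> kD; have [k0|k0|//] := ltrgtP k 0; nia. Qed.

Lemma arcs_arc t u : A (t, u) -> u < t /\ exists k, t - u + 1 = k * D.
Proof.
by case: maxA => Aarc _ /Aarc [ltut /dvdzP [k E]]; split => //; exists k.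
Qed.

Lemma arcs_disjoint t u t' u' : A (t, u) -> A (t', u') ->
  t = t' /\ u = u' \/ t < u' \/ t' < u \/ u < u' /\ t' < t \/
  u' < u /\ t < t'.
Proof.
move=> A1 A2; have [l1 _] := arcs_arc A1; have [l2 _] := arcs_arc A2.
have [E|NE] := pselect ((t, u) = (t', u')); first by left; case: E.
have /maxA.2 /iffLR/(_ A2) /(_ _ A1 NE) := maxA.1 _ A2.
rewrite /touch /=; lia.
Qed.

Lemma arcs_maximal t u : u < t -> (D %| t - u + 1)%Z ->
  exists t' u', A (t', u') /\
    (u <= u' <= t /\ t <= t' \/ u' <= u <= t' /\ t' <= t).
Proof.
move=> ltut dvd; apply: contrapT => none.
have arctu : arc D (t, u) by split.
suff Atu : A (t, u) by apply: none; exists t, u; split => //; lia.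
apply/(maxA.2 _ arctu) => -[t' u'] A' _; apply/negP => tch.
by apply: none; exists t', u'; split => //; move: tch; rewrite /touch /=; lia.
Qed.

(** The free vertices of a closed interval, in increasing order, have
    consecutive residues modulo [D]: induct on the lower end [a], which is
    either free or the lower endpoint of an arc. *)
Lemma region_free_seq a b : a <= b + 1 -> closed_region A a b ->
  exists s : seq int, [/\ sorted <%R s,
    forall v, v \in s <-> region_free A a b v,
    forall i, (i < size s)%N -> (D %| nth 0 s i - a - i%:Z)%Z &
    (D %| b + 1 - a - (size s)%:Z)%Z].
Proof.
have [n] := ubnP (absz (b + 1 - a)%R).
elim: n a => // n IHn a ltn ab cl.
have [ba|{}ab] := ltP b a.
  exists [::]; split => //=; last by rewrite (_ : _ - _ = 0) ?dvdz0 //; lia.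
  by move=> v; split => // -[]; lia.
(* An arc starting at [a] is outermost: remove its t - a + 1 vertices. *)
have [[t Aa]|NAa] := pselect (exists t, A (t, a)).
  have [lta [k Ek]] := arcs_arc Aa.
  have tb := cl _ _ Aa.
  have [|||s [ss sP sD sS]] := IHn (t + 1); try lia.
    move=> x y Axy; have := cl _ _ Axy; have := arcs_disjoint Aa Axy.
    by have [] := arcs_arc Axy; lia.
  exists s; split => //.
  - move=> v; rewrite sP; split => -[vb vf].
      split=> [|x y Axy ay xb]; first lia.
      have [_ ] := arcs_arc Axy; have := vf _ _ Axy.
      by have := arcs_disjoint Aa Axy; lia.
    have := vf _ _ Aa; split; first lia.
    by move=> x y Axy yt xb; apply: vf => //; lia.
  - move=> i /sD /dvdzP [q E]; apply/dvdzP; exists (q + k); lia.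
  - case/dvdzP: sS => q E; apply/dvdzP; exists (q + k); lia.
(* Otherwise [a] is free: remove it. *)
have NAa' t u : A (t, u) -> a <= u <= b -> a < u < b.
  move=> Atu ub; have := cl _ _ Atu; have [] := arcs_arc Atu.
  have [ua|] := eqVneq u a; last lia.
  by case: NAa; exists t; rewrite -ua.
have [|||s [ss sP sD sS]] := IHn (a + 1); try lia.
  move=> x y Axy; have := cl _ _ Axy; have := NAa' _ _ Axy.
  by have [] := arcs_arc Axy; lia.
exists (a :: s); split => //=.
- rewrite path_min_sorted //; apply/allP => v /sP [] /=; lia.
- move=> v; rewrite inE; split.
    case/orP => [/eqP ->|/sP [vb vf]].
      split; first lia; move=> x y Axy ay xb; have := NAa' _ _ Axy.
      by have [] := arcs_arc Axy; lia.
    split; first lia; move=> x y Axy ay xb; have := NAa' _ _ Axy.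
    by have := vf _ _ Axy; have [] := arcs_arc Axy; lia.
  case=> vb vf; have [//|va] := eqVneq v a; apply/sP; split; first lia.
  by move=> x y Axy ay xb; apply: vf => //; lia.
- case=> [|i] /=; first by rewrite subrr subr0 dvdz0.
  have -> : nth 0 s i - a - i.+1%:Z = nth 0 s i - (a + 1) - i%:Z by lia.
  exact: sD.
- have -> : b + 1 - a - (size s).+1%:Z = b + 1 - (a + 1) - (size s)%:Z by lia.
  exact: sS.
Qed.

(** With at least [D] free vertices, the first and the [D]-th of them would be
    the endpoints of an arc, which touches no arc of the family. *)
Lemma region_free_size a b s : closed_region A a b -> sorted <%R s ->
  (forall v, v \in s <-> region_free A a b v) ->
  (forall i, (i < size s)%N -> (D %| nth 0 s i - a - i%:Z)%Z) ->
  (size s)%:Z < D.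
Proof.
move=> cl ss sP sD; rewrite ltNge; apply/negP => leDs.
have [m mE] : exists m : nat, m%:Z = D - 1 by exists (absz (D - 1)%R); lia.
have m_lt : (m < size s)%N by lia.
have s_gt0 : (0 < size s)%N by lia.
have /sP [v1b v1f] := mem_nth 0 s_gt0; have /sP [vDb vDf] := mem_nth 0 m_lt.
set v1 := nth 0 s 0 in v1b v1f; set vD := nth 0 s m in vDb vDf.
have lt1D : v1 < vD.
  by apply: (sorted_ltn_nth lt_trans) => //; rewrite ?inE //; lia.
have [k1 E1] := dvdzP (sD _ s_gt0); have [kD ED] := dvdzP (sD _ m_lt).
have [|t [u [Atu]]] := arcs_maximal lt1D.
  by rewrite -/v1 -/vD in E1 ED *; apply/dvdzP; exists (kD - k1 + 1); lia.
have := cl _ _ Atu; have := v1f _ _ Atu; have := vDf _ _ Atu; lia.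
Qed.

Lemma region_freeP a b : a <= b + 1 -> closed_region A a b ->
  exists s : seq int, [/\ uniq s,
    forall v, v \in s <-> region_free A a b v, (size s)%:Z < D &
    exists k, b + 1 - a - (size s)%:Z = k * D].
Proof.
move=> ab cl; have [s [ss sP sD /dvdzP sS]] := region_free_seq ab cl.
exists s; split => //; last exact: region_free_size ss sP sD.
by apply: sorted_uniq ss; [exact: lt_trans | exact: ltxx].
Qed.

(** A nonempty closed interval whose size b - a + 1 is -1 modulo [D]. *)
Definition special_region a b : Prop :=
  [/\ a <= b, closed_region A a b & (D %| b - a + 2)%Z].

Lemma special_region_intro a b : a <= b + 1 -> closed_region A a b ->
  (D %| b - a + 2)%Z -> special_region a b.
Proof.
move=> ab cl dvd; split=> //; have [//|ba] := leP a b.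
by case/dvdzP: dvd => l El; have := @small_multiple l; rewrite -El; lia.
Qed.

Lemma special_region_free a b : special_region a b ->
  exists s : seq int, [/\ uniq s,
    forall v, v \in s <-> region_free A a b v & (size s)%:Z = D - 1].
Proof.
case=> ab cl /dvdzP [q Eq].
have [|s [us sP sD [k Ek]]] := region_freeP _ cl; first lia.
exists s; split => //.
suff : (size s)%:Z + 1 = D by lia.
have E : (size s)%:Z + 1 = (q - k) * D by lia.
have : q - k - 1 = 0 by apply: small_multiple; lia.
by move=> E1; rewrite E (_ : q - k = 1) ?mul1r //; lia.
Qed.

(** The induction on the length of the overarc (t, u) treats it as innermost;
    its interior has t - u - 1, that is -2 modulo [D], vertices. *)
Lemma special_region_uncovered a b t u : special_region a b -> A (t, u) ->
  ~ (u < a /\ b < t).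
Proof.
move=> spec; have [s1 [us1 s1P s1S]] := special_region_free spec.
case: spec => ab cl _.
have [n] := ubnP (absz (t - u)%R); elim: n t u => // n IHn t u ltn Atu [ua bt].
have [k Ek] := (arcs_arc Atu).2.
have [||s2 [us2 s2P s2D [q Eq]]] := @region_freeP (u + 1) (t - 1); first lia.
  move=> x y Axy; have := arcs_disjoint Atu Axy; have [] := arcs_arc Axy; lia.
(* A vertex free in [a, b] stays free in the interior: an arc of the interior
   containing it would cover [a, b] and be shorter than (t, u). *)
have sub : {subset s1 <= s2}.
  move=> v /s1P [vb vf]; apply/s2P; split; first lia.
  move=> x y Axy uy xt; have := cl _ _ Axy; have := vf _ _ Axy.
  by have := IHn x y _ Axy; lia.
have le12 : (size s1 <= size s2)%N := uniq_leq_size us1 sub.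
have s2S : (size s2)%:Z = D - 1 by lia.
have kq : (k - q - 1) * D = 1 by lia.
by have := @small_multiple (k - q - 1); rewrite kq; lia.
Qed.

(** The arc [z] joins the far end of the arc on the left of the interval to the
    near end of the arc on its right; nothing else touches [z]. *)
Lemma special_region_not_left a b : special_region a b ->
  exists2 z, arc D z & forall x, A x -> ~~ left_touch D x z.
Proof.
move=> spec; have unc := special_region_uncovered spec.
case: spec => ab cl /dvdzP [k Ek].
(* If a neighbour of [a, b] were not an endpoint, adding it would give a closed
   interval of size 0 modulo [D] with at least one free vertex. *)
have next v : v = a - 1 \/ v = b + 1 ->
    exists x y, A (x, y) /\ (x = v \/ y = v).
  move=> vE; apply: contrapT => none.
  have vNend x y : A (x, y) -> x <> v /\ y <> v.
    by move=> Axy; split=> E; apply: none; exists x, y; split => //; auto.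
  have [||s [us sP sD [q Eq]]] := @region_freeP (Order.min a v) (Order.max b v).
  - lia.
  - by move=> x y Axy; have := cl _ _ Axy; have := vNend _ _ Axy; lia.
  have vs : v \in s.
    apply/sP; split; first lia; move=> x y Axy.
    by have := vNend _ _ Axy; have := arcs_arc Axy; lia.
  have s_gt0 : (0 < size s)%N by case: s vs {us sP sD Eq}.
  have sE : (size s)%:Z = (k - q) * D by lia.
  by have := @small_multiple (k - q); rewrite -sE; lia.
have [|t1 [y [A1 bE]]] := next (b + 1); first by right.
have yE : y = b + 1.
  case: bE A1 => // -> A1; have := unc _ _ A1; have := cl _ _ A1.
  by have [] := arcs_arc A1; lia.
have [|x [u0 [A0 aE]]] := next (a - 1); first by left.
have xE : x = a - 1.
  case: aE A0 => // -> A0; have := unc _ _ A0; have := cl _ _ A0.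
  by have [] := arcs_arc A0; lia.
rewrite {}yE {bE} in A1; rewrite {}xE {aE} in A0.
have [lt0 [k0 E0]] := arcs_arc A0; have [lt1 [k1 E1]] := arcs_arc A1.
exists (b + 1, u0); first split => /=; first lia.
  by apply/dvdzP; exists (k0 + k); lia.
case=> t u Atu; rewrite /left_touch /=.
have [uE|ub] := eqVneq u (b + 1).
  by rewrite uE subrr dvdz0 /= andbF /=; have := arcs_arc Atu; lia.
have [uE|u0N] := eqVneq u u0.
  rewrite uE subrr dvdz0 /= !andbF orbF.
  by have := arcs_disjoint A0 Atu; have := arcs_arc Atu; lia.
have := arcs_disjoint A0 Atu; have := arcs_disjoint A1 Atu.
have := unc _ _ Atu; have := cl _ _ Atu; have := arcs_arc Atu; lia.
Qed.

(** With z = (t', u'), the interval lies between the outermost arcs of the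
    family containing only one end of [z], or begins at u' if no such arc
    contains u'; on the upper side an arc from t' to below u' can also delimit
    it. *)
Lemma not_left_special_region z : arc D z ->
  (forall x, A x -> ~~ left_touch D x z) -> exists a b, special_region a b.
Proof.
case: z => t' u' [/= lt' /dvdzP [k' Ek']] bad.
have badA t u : A (t, u) -> u' <= u <= t' -> t' <= t -> (D %| t' - u)%Z.
  by move=> Atu; have := bad _ Atu; rewrite /left_touch /=; lia.
have badB t u : A (t, u) -> u <= u' <= t -> t <= t' -> (D %| u' - u)%Z.
  by move=> Atu; have := bad _ Atu; rewrite /left_touch /=; lia.
(* The highest upper endpoint, below t', of an arc containing u'. *)
have [||p [pb pP pm]] :=
  @max_below (fun s => exists u, A (s, u) /\ u <= u' <= s /\ s < t') u' t'.
- lia.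
- by move=> s [u [_]]; lia.
have {}pm t u : A (t, u) -> u <= u' <= t -> t < t' -> t <= p.
  by move=> Atu ? ?; apply: pm; exists u.
have [j Ej] : exists j, p + 1 - u' = j * D.
  case: pP => [->|[u [Apu [up pt]]]]; first by exists 0; lia.
  have /dvdzP [l El] := badB _ _ Apu up (ltW pt).
  have [_ [m Em]] := arcs_arc Apu; exists (m - l); lia.
(* The lowest lower endpoint, from u' on, of an arc containing t'. *)
have [||q [qb qP qm]] :=
  @min_above (fun s => exists t, A (t, s) /\ u' <= s <= t' /\ t' <= t) u' t'.
- lia.
- move=> s [t [Ats [st tt]]]; have [us|] := eqVneq s u'; last lia.
  have /dvdzP [l El] := badA _ _ Ats st tt.
  have l1 : (k' - l) * D = 1 by lia.
  by have := @small_multiple (k' - l); rewrite l1; lia.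
have {}qm t u : A (t, u) -> u' <= u <= t' -> t' <= t -> q <= u.
  by move=> Atu ? ?; apply: qm; exists t.
have pq : p < q.
  case: qP => [|[t [Atq [qt tt]]]]; first lia.
  case: pP => [|[u [Apu [up pt]]]]; first lia.
  by have := arcs_disjoint Apu Atq; lia.
have pcl t u : A (t, u) -> u <= p -> p < t -> u < u' /\ t' <= t.
  move=> Atu up pt; have := pm _ _ Atu; have := arcs_arc Atu.
  case: pP => [|[v [Apv [vu _]]]]; first lia.
  by have := arcs_disjoint Apv Atu; lia.
(* If [q] is the lower endpoint of an arc, then [p + 1, q - 1] is special. *)
case: qP => [qE|[t [Atq [qt tt]]]]; last first.
  have [m Em] := dvdzP (badA _ _ Atq qt tt).
  exists (p + 1), (q - 1); apply: special_region_intro; first lia; last first.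
    by apply/dvdzP; exists (k' - m - j); lia.
  move=> x y Axy; have := pcl _ _ Axy; have := qm _ _ Axy.
  by have := arcs_disjoint Atq Axy; have := arcs_arc Axy; lia.
(* An arc from t' to below u' plays the same role, at t' instead of [q]. *)
have [[u0 [A0 u0u]]|none] := pselect (exists u0, A (t', u0) /\ u0 < u').
  exists (p + 1), (t' - 1); apply: special_region_intro; first lia; last first.
    by apply/dvdzP; exists (k' - j); lia.
  move=> x y Axy; have := pcl _ _ Axy; have := qm _ _ Axy.
  by have := arcs_disjoint A0 Axy; have := arcs_arc Axy; lia.
(* Otherwise t' is free in [p + 1, t'], which is closed of size 0 modulo [D]. *)
have t'N t u : A (t, u) -> t <> t'.
  move=> Atu tE; have := qm _ _ Atu; have := arcs_arc Atu.
  have [uu|] := ltP u u'; last lia.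
  by case: none; exists u; rewrite -tE.
have [||s [_ sP sD [m Em]]] := @region_freeP (p + 1) t'; first lia.
  move=> x y Axy; have := pcl _ _ Axy; have := qm _ _ Axy.
  by have := t'N _ _ Axy; have := arcs_arc Axy; lia.
have t's : t' \in s.
  apply/sP; split; first lia; move=> x y Axy.
  by have := t'N _ _ Axy; lia.
have s_gt0 : (0 < size s)%N by case: s t's {sP sD Em}.
have sE : (size s)%:Z = (k' - j - m) * D by lia.
by have := @small_multiple (k' - j - m); rewrite -sE; lia.
Qed.

Lemma special_region_isolated a b v : special_region a b ->
  region_free A a b v -> isolated_uncovered A v.
Proof.
move=> spec [vb vf]; case: (spec) => _ cl _.
split=> [t u Atu|[[t u] [Atu /= uvt]]]; have := cl _ _ Atu; have := vf _ _ Atu;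
  have := arcs_arc Atu; last have := special_region_uncovered spec Atu; lia.
Qed.

Lemma special_region_seqP :
  (exists a b, special_region a b) <->
  exists s : seq int, [/\ uniq s,
    forall v, v \in s -> isolated_uncovered A v & (size s)%:Z = D - 1].
Proof.
split=> [[a [b spec]]|[s [us sI sS]]].
  have [s [us sP sS]] := special_region_free spec.
  by exists s; split=> // v /sP; exact: special_region_isolated.
have s_gt0 : (0 < size s)%N by lia.
(* The interval spanned by [s] has at most D - 1 free vertices, hence exactly
   those in [s]. *)
have [a [b [as_ bs sab]]] := seq_bounds s_gt0.
have [aI aU] := sI _ as_; have [bI bU] := sI _ bs.
have cl : closed_region A a b.
  move=> t u Atu; have := aI _ _ Atu; have := bI _ _ Atu; have := arcs_arc Atu.
  have : ~ u < a < t by move=> uat; apply: aU; exists (t, u).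
  have : ~ u < b < t by move=> ubt; apply: bU; exists (t, u).
  lia.
have ab : a <= b by have := sab _ as_; lia.
exists a, b; split=> //.
have [|s1 [us1 s1P s1D [k Ek]]] := region_freeP _ cl; first lia.
have ss1 : (size s <= size s1)%N.
  apply: uniq_leq_size us _ => v vs; apply/s1P; split; first exact: sab.
  move=> t u Atu _ _; have [vI vU] := sI _ vs; have := vI _ _ Atu.
  have : ~ u < v < t by move=> uvt; apply: vU; exists (t, u).
  lia.
by apply/dvdzP; exists (k + 1); lia.
Qed.

Lemma left_special_regionP :
  (forall z, arc D z -> exists2 x, A x & left_touch D x z) <->
  ~ exists a b, special_region a b.
Proof.
split=> [left [a [b spec]]|nspec z arcz].
  have [z arcz bad] := special_region_not_left spec.
  by have [x Ax] := left _ arcz; rewrite (negbTE (bad _ Ax)).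
apply: contrapT => none; apply/nspec/(not_left_special_region arcz) => x Ax.
by apply/negP => xz; apply: none; exists x.
Qed.

Lemma left_isolatedP :
  (forall z, arc D z -> exists2 x, A x & left_touch D x z) <->
  ~ exists s : seq int, [/\ uniq s,
    forall v, v \in s -> isolated_uncovered A v & (size s)%:Z = D - 1].
Proof. by rewrite left_special_regionP special_region_seqP. Qed.

End Config.

(** * Reflection of the line of vertices *)

(** The image of an arc under v |-> - v, which exchanges upper and lower. *)
Definition reflect_arc (a : int * int) : int * int := (- a.2, - a.1).

Lemma reflect_arcK : involutive reflect_arc.
Proof. by case=> t u; rewrite /reflect_arc /= !opprK. Qed.

Definition reflect_arcs (A : set (int * int)) : set (int * int) :=
  [set a | A (reflect_arc a)].

Lemma arc_reflect D a : arc D (reflect_arc a) <-> arc D a.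
Proof.
by case: a => t u; rewrite /arc /= opprK ltrN2 (addrC (- u)).
Qed.

Lemma touch_reflect a b : touch (reflect_arc a) (reflect_arc b) = touch a b.
Proof. by case: a b => [t u] [t' u']; rewrite /touch /=; lia. Qed.

(** The reflection exchanges the roles of the two arcs. *)
Lemma left_touch_reflect D a b : arc D a -> arc D b ->
  left_touch D (reflect_arc a) (reflect_arc b) = left_touch D b a.
Proof.
case: a b => [t u] [t' u'] [/= ltut /dvdzP[k Ek]] [/= ltut' /dvdzP[k' Ek']].
have E1 : (D %| - u' - - t)%Z = (D %| t - u')%Z.
  by rewrite opprK addrC.
have E2 : (D %| - t' - - t)%Z = (D %| u - u')%Z.
  apply/dvdzP/dvdzP => -[l El].
    by exists (l + k' - k); lia.
  by exists (l + k - k'); lia.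
rewrite /left_touch /= E1 E2 !lerN2.
by do ![case: (_ <= _) => //=]; case: (_ %| _)%Z => //=; case: (_ %| _)%Z.
Qed.

Lemma maximal_arcs_reflect D A :
  maximal_arcs D A -> maximal_arcs D (reflect_arcs A).
Proof.
case=> arcA maxA; split=> [a /arcA /arc_reflect //|a arca].
have /maxA maxa : arc D (reflect_arc a) by apply/arc_reflect.
rewrite /reflect_arcs /= maxa; split=> [h x Ax xa|h x Ax xa].
  rewrite -touch_reflect; apply: h => //.
  by apply: contra_not xa => /(congr1 reflect_arc); rewrite !reflect_arcK.
rewrite -[x]reflect_arcK touch_reflect; apply: h; first by rewrite reflect_arcK.
by apply: contra_not xa => <-; rewrite reflect_arcK.
Qed.

Lemma isolated_uncovered_reflect A v :
  isolated_uncovered (reflect_arcs A) v <-> isolated_uncovered A (- v).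
Proof.
rewrite /isolated_uncovered /isolated /overarc /reflect_arcs /reflect_arc /=.
split=> -[vI vU]; split=> [t u Atu|[[t u] /= [Atu tuv]]].
- by have := vI (- u) (- t); rewrite !opprK => /(_ Atu); lia.
- by apply: vU; exists (- u, - t); rewrite /= !opprK; split=> //; lia.
- by have := vI _ _ Atu; lia.
- by apply: vU; exists (- u, - t); split=> //=; lia.
Qed.

Lemma right_isolatedP D A : 2 <= D -> maximal_arcs D A ->
  (forall z, arc D z -> exists2 x, A x & left_touch D z x) <->
  ~ exists s : seq int, [/\ uniq s,
    forall v, v \in s -> isolated_uncovered A v & (size s)%:Z = D - 1].
Proof.
move=> D2 maxA; have maxA' := maximal_arcs_reflect maxA.
transitivity (forall z, arc D z ->
    exists2 x, reflect_arcs A x & left_touch D x z).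
  have arcA := maxA.1; have arcA' := maxA'.1.
  split=> right z arcz; have /right[x Ax zx] : arc D (reflect_arc z) by
    apply/arc_reflect.
    exists (reflect_arc x); first by rewrite /reflect_arcs /= reflect_arcK.
    rewrite -[z]reflect_arcK left_touch_reflect //; first exact: arcA.
    exact/arc_reflect.
  exists (reflect_arc x) => //; rewrite -left_touch_reflect ?reflect_arcK //.
  exact/arc_reflect/arcA'.
rewrite (left_isolatedP D2 maxA').
split; apply: contra_not => -[s [us sI sS]]; exists (map -%R s); split;
  rewrite ?size_map ?(map_inj_uniq oppr_inj) // => _ /mapP[v vs ->].
  by apply/isolated_uncovered_reflect; rewrite opprK; exact: sI.
by apply/isolated_uncovered_reflect; exact: sI.
Qed.

(** * Counting *)

Lemma not_card_le_II (T : choiceType) (A : set T) n :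
  ~ (A #<= `I_n) <->
  exists s : seq T, [/\ uniq s, forall x, x \in s -> A x & size s = n.+1].
Proof.
split=> [nA|[s [us sA sS]] leA]; last first.
  have [x0 _] : exists x0, x0 \in s.
    by case: s sS {us sA} => // x s _; exists x; rewrite mem_head.
  have : `I_n.+1 #<= A.
    have /injfunPex[f] : exists2 f, set_fun `I_n.+1 A f & set_inj `I_n.+1 f.
      exists (nth x0 s) => [i /= lti|i j];
        first by apply/sA/mem_nth; rewrite sS.
      by rewrite !inE /= => lti ltj /eqP; rewrite nth_uniq ?sS // => /eqP.
    exact: inj_card_le.
  by move=> /card_le_trans/(_ leA); rewrite card_le_II ltnn.
have [s [us sA sS]] : exists s : seq T,
    [/\ uniq s, forall x, x \in s -> A x & (n < size s)%N].
  have [/finite_seqP[s As]|/(@infinite_set_fset _ _ n.+1)[X XA Xn]] :=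
    pselect (finite_set A); last first.
    by exists (finmap.enum_fset X); split=> //; exact: finmap.fset_uniq.
  exists (undup s); split; first exact: undup_uniq.
    by move=> x; rewrite mem_undup As.
  rewrite ltnNge; apply/negP => les; apply: nA.
  have /injfunPex[f] : exists2 f, set_fun A `I_n f & set_inj A f.
    exists (index^~ (undup s)) => [x|x y].
      rewrite As /= => xs; apply: leq_trans les.
      by rewrite index_mem mem_undup.
    rewrite As !inE /= => xs ys E.
    by apply: (index_inj x _ _ E); rewrite ?mem_undup.
  exact: inj_card_le.
exists (take n.+1 s); split; first exact: take_uniq.
  by move=> x /mem_take; exact: sA.
by rewrite size_takel.
Qed.

(** * Isomorphism invariance in linear and triangulated categories *)

Section LinearCategory.
Variables (K : fieldType) (C : linCat K).
Implicit Types x y z : C.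
Local Open Scope cat_scope.

Lemma compm0l x y z (f : homs x y) : (0 : homs y z) \oo f = 0.
Proof.
have := comp_linl (-1) (0 : homs y z) 0 f.
by rewrite scaler0 addr0 scaleN1r addNr.
Qed.

Lemma compm0r x y z (g : homs y z) : g \oo (0 : homs x y) = 0.
Proof.
have := comp_linr (-1) g (0 : homs x y) 0.
by rewrite scaler0 addr0 scaleN1r addNr.
Qed.

Lemma isomorphic_refl x : isomorphic x x.
Proof. by exists (idmor x), (idmor x); rewrite comp1m. Qed.

Lemma isomorphic_sym x y : isomorphic x y -> isomorphic y x.
Proof. by case=> f [g gf fg]; exists g, f. Qed.

Lemma isomorphic_trans x y z :
  isomorphic x y -> isomorphic y z -> isomorphic x z.
Proof.
case=> f [f' f'f ff'] [g [g' g'g gg']]; exists (g \oo f), (f' \oo g').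
  by rewrite Defs.compA -(Defs.compA f') g'g compm1.
by rewrite Defs.compA -(Defs.compA g) ff' compm1.
Qed.

Lemma homs_zero_iso x x' y y' : isomorphic x x' -> isomorphic y y' ->
  (forall f : homs x y, f = 0) -> forall f : homs x' y', f = 0.
Proof.
case=> a [a' a'a aa'] [b [b' b'b bb']] hom0 f.
have -> : f = b \oo (b' \oo f \oo a) \oo a'.
  by rewrite -!Defs.compA aa' compm1 Defs.compA bb' comp1m.
by rewrite (hom0 (b' \oo f \oo a)) compm0r compm0l.
Qed.

End LinearCategory.

Lemma isomorphic_functor (K : fieldType) (C D : linCat K) (F : linFunctor C D)
    (x y : C) : isomorphic x y -> isomorphic (F x) (F y).
Proof.
case=> f [g gf fg]; exists (fmap F f), (fmap F g).
  by rewrite -fmapM gf fmap1.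
by rewrite -fmapM fg fmap1.
Qed.

Lemma has_dim0 (K : fieldType) (V : lmodType K) :
  has_dim V 0 -> forall x : V, x = 0.
Proof.
by case=> f _ [g fK _] x; rewrite -[x]fK -[0]fK [f x]thinmx0 [f 0]thinmx0.
Qed.

Lemma has_dim1 (K : fieldType) (V : lmodType K) :
  has_dim V 1 -> ~ forall x : V, x = 0.
Proof.
case=> f _ [g _ gK] V0; have : (const_mx 1 : 'rV[K]_1) = 0.
  by rewrite -[LHS]gK -[RHS]gK (V0 (g _)) [in RHS](V0 (g _)).
by move=> /matrixP/(_ 0 0)/eqP; rewrite !mxE oner_eq0.
Qed.

Section Shift.
Variables (K : fieldType) (T : triCat K).
Implicit Types x y : T.

Lemma isomorphic_shiftz i x y :
  isomorphic x y -> isomorphic (shiftz i x) (shiftz i y).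
Proof.
move=> xy; case: i => n /=.
  by elim: n => //= n; exact: isomorphic_functor.
apply: isomorphic_functor.
by elim: n => //= n; exact: isomorphic_functor.
Qed.

Lemma Ext_zero_iso i x x' y y' : isomorphic x x' -> isomorphic y y' ->
  Ext_zero i x y -> Ext_zero i x' y'.
Proof.
by move=> xx' yy'; exact: homs_zero_iso xx' (isomorphic_shiftz i yy').
Qed.

End Shift.


Lemma arc_shift D t u j : arc D (t, u) -> arc D (t + j, u + j).
Proof.
case=> /= ltut dvd; split=> /=; first by rewrite ltrD2r.
by have -> : t + j - (u + j) + 1 = t - u + 1 by lia.
Qed.

(** * Nonzero morphisms between arcs *)

Section HomArc.
Variables (D : int) (D2 : 2 <= D).

Lemma admissibleP a : admissible (1 - D) a <-> arc D a.
Proof.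
case: a => t u; rewrite /admissible /arc /=.
have dE : 1 - D - 1 = - D by lia.
have modE : (u - t = 1 %[mod 1 - D - 1])%Z <-> (D %| t - u + 1)%Z.
  rewrite dE !modzN; split.
    move=> /eqP; rewrite eqz_mod_dvd => /dvdzP[k E].
    by apply/dvdzP; exists (- k); lia.
  move=> /dvdzP[k E]; apply/eqP; rewrite eqz_mod_dvd.
  by apply/dvdzP; exists (- k); lia.
split=> [[ltut _ /modE]|[ltut dvd]] //; split=> //; last exact/modE.
have /dvdzP[k E] := dvd; have := @pos_multiple D k; lia.
Qed.

(** The values t + i d with 0 <= i < k of the arc model are the vertices in
    ]u, t] congruent to t modulo [D]. *)
Lemma hom_arcP t u t' u' : arc D (t, u) -> arc D (t', u') ->
  hom_arc (1 - D) (t, u) (t', u') <->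
  [/\ u < t' <= t, (D %| t - t')%Z & u' <= u] \/
  [/\ u < u' <= t, (D %| t - u')%Z & t < t'].
Proof.
move=> arca arcb; have admb : admissible (1 - D) (t', u') by apply/admissibleP.
case: arca arcb => /= ltut /dvdzP[q Eq] [/= ltut' /dvdzP[q' Eq']].
have kE : ((u - t - 1) %/ (1 - D - 1))%Z = q.
  have -> : u - t - 1 = q * (1 - D - 1) by lia.
  by rewrite mulzK //; apply/eqP; lia.
rewrite /hom_arc kE; split.
  case=> _ [i [iq [[v vu [-> ->]]|[z tz [-> ->]]]]].
    left; split=> //; last by apply/dvdzP; exists i; lia.
    by have := @pos_multiple D (q - i); nia.
  right; split; last lia.
    by have := @pos_multiple D (q - i); nia.
  by apply/dvdzP; exists (q - 1 - i); lia.
case=> -[ub /dvdzP[l El] v]; split=> //.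
  exists l; split; first by nia.
  by left; exists u' => //; congr pair; lia.
exists (q - 1 - l); split; first by nia.
right; exists t'; last by congr pair; lia.
by have := @pos_multiple D (q' - l); lia.
Qed.

(** A shift by less than [D] that brings an endpoint of the second arc into the
    class of [t] modulo [D] brings the other one into a class determined by it;
    such a rounding up does not change their positions relative to [t] and
    [u]. *)
Lemma hom_arc_shift t u t' u' j :
  arc D (t, u) -> arc D (t', u') -> 0 <= j < D ->
  hom_arc (1 - D) (t, u) (t' + j, u' + j) <->
  [/\ u' <= u <= t', t' <= t & (D %| t - t' - j)%Z] \/
  [/\ u <= u' <= t, t <= t' & (D %| t - u' - j)%Z].
Proof.
move=> arca arcb jD.
transitivity ([/\ u < t' + j <= t, (D %| t - t' - j)%Z & u' + j <= u] \/
    [/\ u < u' + j <= t, (D %| t - u' - j)%Z & t < t' + j]).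
  by rewrite (hom_arcP arca (arc_shift j arcb)) !opprD !addrA.
case: arca arcb => /= ltut /dvdzP[q Eq] [/= ltut' /dvdzP[q' Eq']].
split=> -[[b1 b2 b3]|[b1 b2 b3]]; [left|right|left|right]; split=> //.
(* Each inequality amounts to comparing a multiple of [D] with 0. *)
all: try (case/dvdzP: b2 => l El); try (case/dvdzP: b3 => l El).
all: have P1 := @pos_multiple D (q - l); have P2 := @pos_multiple D (l + 1).
all: have P3 := @pos_multiple D (q' - l).
all: have P4 := @pos_multiple D (l + q' - q + 1).
all: try lia.
Qed.

Lemma residue_shift v : exists2 j, 0 <= j < D & (D %| v - j)%Z.
Proof.
have D0 : D != 0 by lia.
exists (v %% D)%Z; first by rewrite modz_ge0 // ltz_pmod; lia.
by apply/dvdzP; exists (v %/ D)%Z; rewrite {1}(divz_eq v D) addrK.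
Qed.

Lemma touchP x t u : arc D x -> arc D (t, u) ->
  touch x (t, u) <->
  exists2 i : int, 1 - D <= i <= 0 & hom_arc (1 - D) x (t - i, u - i).
Proof.
case: x => t0 u0 arcx arcy; split=> [|[i iD]].
  rewrite /touch /= => /orP[] /and3P[le1 le2 le3].
    have [j jD dvd] := residue_shift (t0 - t); exists (- j); first by lia.
    by rewrite opprK; apply/hom_arc_shift => //; left; rewrite le1 le2 le3.
  have [j jD dvd] := residue_shift (t0 - u); exists (- j); first by lia.
  by rewrite opprK; apply/hom_arc_shift => //; right; rewrite le1 le2 le3.
have jD : 0 <= - i < D by lia.
by case/(hom_arc_shift arcx arcy jD) => -[b1 b2 _]; rewrite /touch /=; lia.
Qed.

Lemma left_touchP x t u : arc D x -> arc D (t, u) ->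
  left_touch D x (t, u) <->
  exists2 i : int, 2 - D <= i <= 0 & hom_arc (1 - D) x (t - i, u - i).
Proof.
case: x => t0 u0 arcx arcy; have [_ /= /dvdzP[q Eq]] := arcx.
(* The shift by D - 1 is the one excluded from the range of [i]. *)
have lastP v j : 0 <= j < D -> (D %| t0 - v - j)%Z ->
    (D %| v - u0)%Z = (j == D - 1).
  move=> jD /dvdzP[l El]; apply/dvdzP/eqP => [[m Em]|jE].
    have := @pos_multiple D (q - l - m).
    by have := @pos_multiple D (l + m + 1 - q); lia.
  by exists (q - 1 - l); lia.
split=> [|[i iD]].
  rewrite /left_touch /= => /orP[] /and3P[b1 b2 b3].
    have [j jD dvd] := residue_shift (t0 - t).
    rewrite (lastP _ _ jD dvd) in b3; exists (- j); first by lia.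
    by rewrite opprK; apply/hom_arc_shift => //; left.
  have [j jD dvd] := residue_shift (t0 - u).
  rewrite (lastP _ _ jD dvd) in b3; exists (- j); first by lia.
  by rewrite opprK; apply/hom_arc_shift => //; right.
have jD : 0 <= - i < D by lia.
rewrite /left_touch /=.
case/(hom_arc_shift arcx arcy jD) => -[b1 b2 /(lastP _ _ jD) ->]; rewrite b1 b2.
  by apply/orP; left; lia.
by apply/orP; right; lia.
Qed.

End HomArc.

(** * From objects to arcs *)

Section ArcModel.
Variables (K : fieldType) (D : int) (D2 : 2 <= D) (T : triCat K).
Variable M : arc_model (1 - D) T.

Lemma admissible_shift t u i :
  admissible (1 - D) (t, u) -> admissible (1 - D) (t + i, u + i).
Proof.
have addrKi x y : x + i - (y + i) = x - y by lia.
by rewrite /admissible ltrD2r !addrKi.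
Qed.

Lemma shiftz_arc i t u : admissible (1 - D) (t, u) ->
  isomorphic (shiftz i (M (t, u))) (M (t - i, u - i)).
Proof.
have desuspM t' u' : admissible (1 - D) (t', u') ->
    isomorphic (desusp T (M (t', u'))) (M (t' + 1, u' + 1)).
  move=> adm; have := obj_susp M (admissible_shift 1 adm); rewrite !addrK.
  move=> /(isomorphic_functor (desusp T))/isomorphic_sym h.
  apply: isomorphic_trans h _.
  exists (susp_counit (M (t' + 1, u' + 1))); exact: susp_counit_iso.
move=> adm; case: i => [n|n] /=.
  elim: n => [|n IHn] /=; first by rewrite !subr0; exact: isomorphic_refl.
  apply: isomorphic_trans (isomorphic_functor _ IHn) _.
  have := obj_susp M (admissible_shift (- n%:Z) adm).
  have subrS v : v - n.+1%:Z = v - n%:Z - 1 by lia.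
  by rewrite !subrS.
elim: n => [|n IHn] /=; first exact: desuspM.
apply: isomorphic_trans (isomorphic_functor _ IHn) _.
have := desuspM _ _ (admissible_shift (- Negz n) adm).
have subNegS v : v - Negz n.+1 = v - Negz n + 1 by lia.
by rewrite !subNegS.
Qed.

Lemma Ext_zero_arc i x t u :
  admissible (1 - D) x -> admissible (1 - D) (t, u) ->
  Ext_zero i (M x) (M (t, u)) <-> ~ hom_arc (1 - D) x (t - i, u - i).
Proof.
move=> admx admy; have admy' := admissible_shift (- i) admy.
have iso := shiftz_arc i admy.
transitivity (forall f : homs (M x) (M (t - i, u - i)), f = 0).
  have xx := isomorphic_refl (M x).
  by split; apply: homs_zero_iso => //; exact: isomorphic_sym.
split=> [hom0 hxy|nhxy]; last exact/has_dim0/obj_hom0.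
by apply: has_dim1 hom0; exact: obj_hom1.
Qed.

Lemma Ext_nonzero_arc (lo : int) x z : arc D x -> arc D z ->
  (exists2 i : int, lo <= i <= 0 & ~ Ext_zero i (M x) (M z)) <->
  exists2 i : int, lo <= i <= 0 & hom_arc (1 - D) x (z.1 - i, z.2 - i).
Proof.
case: z => t u /(admissibleP D2) admx /(admissibleP D2) admz.
split=> -[i il h]; exists i => //.
  by apply: contrapT => nh; apply/h/(Ext_zero_arc _ admx admz).
by move=> /(Ext_zero_arc _ admx admz); exact.
Qed.

Lemma Ext_touchP x z : arc D x -> arc D z ->
  touch x z <-> exists2 i : int, 1 - D <= i <= 0 & ~ Ext_zero i (M x) (M z).
Proof.
move=> arcx; case: z => t u arcz; apply: iff_trans (touchP D2 arcx arcz) _.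
by apply: iff_sym; exact: Ext_nonzero_arc.
Qed.

Lemma Ext_left_touchP x z : arc D x -> arc D z ->
  left_touch D x z <->
  exists2 i : int, 1 - D + 1 <= i <= 0 & ~ Ext_zero i (M x) (M z).
Proof.
move=> arcx; case: z => t u arcz; apply: iff_trans (left_touchP D2 arcx arcz) _.
have -> : 1 - D + 1 = 2 - D by lia.
by apply: iff_sym; exact: Ext_nonzero_arc.
Qed.

(** Hence in a Hom-configuration the condition for w < i < 0, which includes the
    case x = h, amounts to the same condition for x other than h. *)
Lemma Ext_zero_self i x : arc D x -> 1 - D + 1 <= i <= -1 ->
  Ext_zero i (M x) (M x).
Proof.
case: x => t u arcx iD; apply/Ext_zero_arc; try exact/(admissibleP D2).
have jD : 0 <= - i < D by lia.
have [ltut /= /dvdzP[q Eq]] := arcx.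
case/(hom_arc_shift D2 arcx arcx jD) => -[_ _ /dvdzP[l El]].
  by have := @pos_multiple D (- l); lia.
by have := @pos_multiple D (q - l); lia.
Qed.

Section Configuration.
Variables (H : set T) (hH : hom_configuration (1 - D) H).
Let A := arcs_of M H.

Lemma arcs_of_surj x : H x -> exists2 a, A a & isomorphic (M a) x.
Proof.
case: hH => -[indH isoH] _ Hx; have [a adm iso] := obj_surj M (indH _ Hx).
by exists a => //; split=> //; apply: isoH Hx _; exact: isomorphic_sym.
Qed.

Lemma arcs_of_arc a : A a -> arc D a.
Proof. by case=> /(admissibleP D2). Qed.

Lemma arcs_of_maximal : maximal_arcs D A.
Proof.
split=> [a|a arca]; first exact: arcs_of_arc.
have adma : admissible (1 - D) a by apply/admissibleP.
have [_ /(_ _ (obj_indec M adma)) Ha] := hH.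
split=> [[_ /Ha[Hmid Hend]] x Ax xa|disj].
  have arcx := arcs_of_arc Ax; case: Ax => admx HMx.
  apply/negP => /(Ext_touchP arcx arca)[i iD]; apply.
  have [i_mid|i_end] : 1 - D + 1 <= i <= -1 \/ (i = 0 \/ i = 1 - D) by lia.
    exact: Hmid i_mid _ HMx.
  apply: Hend i_end _ _; split=> // iso; apply: xa.
  exact: (obj_inj admx adma iso).
have zero i y : 1 - D <= i <= 0 -> H y -> ~ isomorphic y (M a) ->
    Ext_zero i y (M a).
  move=> iD /arcs_of_surj[x Ax xy] nya.
  apply: (Ext_zero_iso xy (isomorphic_refl _)); apply: contrapT => nz.
  have : ~~ touch x a.
    apply: disj => // xa; apply: nya; rewrite -xa; exact: isomorphic_sym xy.
  by apply/negP/negPn/(Ext_touchP (arcs_of_arc Ax) arca); exists i.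
split=> //; apply/Ha; split=> i iD y; last by case=> Hy; apply: zero => //; lia.
move=> Hy; have [iso|niso] := pselect (isomorphic y (M a)).
  apply: Ext_zero_iso (isomorphic_sym iso) (isomorphic_refl _) _.
  exact: Ext_zero_self.
by apply: zero => //; lia.
Qed.

Lemma hom_configuration_orthogonal : riedtmann_orthogonal (1 - D) H.
Proof.
move=> x y /arcs_of_surj[a Aa ax] /arcs_of_surj[b Ab yb] nxy i iD.
apply: (Ext_zero_iso ax yb); apply: contrapT => nz.
have arca := arcs_of_arc Aa; have arcb := arcs_of_arc Ab.
have : ~~ touch a b.
  apply: (arcs_of_maximal.2 _ arcb).1 => // ab; apply: nxy.
  by apply: isomorphic_trans (isomorphic_sym ax) _; rewrite ab.
by apply/negP/negPn/(Ext_touchP arca arcb); exists i.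
Qed.

Lemma left_riedtmannP : left_riedtmann (1 - D) H <->
  forall z, arc D z -> exists2 x, A x & left_touch D x z.
Proof.
split=> [[_ _ gen] z arcz|gen].
  have [|x [/arcs_of_surj[a Aa ax] [i iD nz]]] := gen (M z).
    exact/obj_indec/admissibleP.
  exists a => //; apply/(Ext_left_touchP (arcs_of_arc Aa) arcz).
  by exists i => //; apply: contra_not nz; exact/Ext_zero_iso/isomorphic_refl.
split; [exact: hH.1 | exact: hom_configuration_orthogonal | move=> z indz].
have [b /(admissibleP D2) arcb bz] := obj_surj M indz.
have [x Ax] := gen _ arcb.
case/(Ext_left_touchP (arcs_of_arc Ax) arcb) => i iD nz.
exists (M x); split; first by case: Ax.
exists i => //; apply: contra_not nz.
by apply: Ext_zero_iso; [exact: isomorphic_refl | exact: isomorphic_sym].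
Qed.

Lemma right_riedtmannP : right_riedtmann (1 - D) H <->
  forall z, arc D z -> exists2 x, A x & left_touch D z x.
Proof.
split=> [[_ _ gen] z arcz|gen].
  have [|x [/arcs_of_surj[a Aa ax] [i iD nz]]] := gen (M z).
    exact/obj_indec/admissibleP.
  exists a => //; apply/(Ext_left_touchP arcz (arcs_of_arc Aa)).
  exists i => //; apply: contra_not nz.
  exact: Ext_zero_iso (isomorphic_refl _) ax.
split; [exact: hH.1 | exact: hom_configuration_orthogonal | move=> z indz].
have [b /(admissibleP D2) arcb bz] := obj_surj M indz.
have [x Ax] := gen _ arcb.
case/(Ext_left_touchP arcb (arcs_of_arc Ax)) => i iD nz.
exists (M x); split; first by case: Ax.
exists i => //; apply: contra_not nz.
by apply: Ext_zero_iso; [exact: isomorphic_sym | exact: isomorphic_refl].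
Qed.

End Configuration.

End ArcModel.

Theorem theorem4p3 (K : closedFieldType) (w : int) (hw : w <= -1)
    (T : triCat K) (hT : is_Tw T w) (M : arc_model w T)
    (H : set T) (hH : hom_configuration w H) :
  (left_riedtmann w H <-> right_riedtmann w H) /\
  (right_riedtmann w H <->
   isolated_uncovered (arcs_of M H) #<= `I_(`|w|%N - 1)).
Proof.
have [D wE] : exists D : int, w = 1 - D by exists (1 - w); lia.
move: M H hH {hT}; rewrite {}wE in hw * => M H hH.
have D2 : 2 <= D by lia.
have maxA := arcs_of_maximal D2 M hH.
rewrite (left_riedtmannP D2 M hH) (right_riedtmannP D2 M hH).
rewrite (left_isolatedP D2 maxA) (right_isolatedP D2 maxA); split=> //.
set I := isolated_uncovered _.
have -> : (exists s : seq int, [/\ uniq s, forall v, v \in s -> I v &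
    (size s)%:Z = D - 1]) <-> ~ (I #<= `I_(`|(1 - D)%R|%N - 1)).
  have nE : (`|(1 - D)%R|%N - 1).+1%:Z = D - 1 by lia.
  rewrite not_card_le_II -nE.
  by split=> -[s [us sI sS]]; exists s; split=> //; [case: sS|rewrite sS].
by rewrite notK.
Qed.
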